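(* Let $H$ be a separable infinite-dimensional Hilbert space and let $T \in B(H)$. The following are equivalent: (i) $T$ satisfies the hypothesis of the Hypercyclicity Criterion. (ii) There exist a dense subset $Y$ of $H$ and a sequence $\{n_k\}$ of positive integers such that the sequence of operators $\{T^{n_k}\}_k$ is hypercyclic and $T^{n_k} y \to 0$ as $k \to \infty$ for every $y \in Y$. (iii) There exists a sequence $\{n_k\}$ of positive integers such that for each pair $U, V$ of non-empty open subsets of $H$ there is $N \geq 1$ such that $T^{n_k} U \cap V \neq \emptyset$ for every $k \geq N$.
   Context: $B(H)$ is the algebra of bounded linear operators on $H$. An operator $T \in B(H)$ satisfies the hypothesis of the Hypercyclicity Criterion if there exist two dense subsets $Y$ and $Z$ of $H$ and a sequence $\{n_k\}_{k\ge 1}$ of positive integers such that: (1) $T^{n_k} y \to 0$ as $k\to\infty$ for every $y \in Y$; and (2) there exist functions $S_{n_k} : Z \to H$ (not assumed linear or continuous) such that for every $z \in Z$, $S_{n_k} z \to 0$ and $T^{n_k} S_{n_k} z \to z$ as $k \to \infty$. Dense subsets are not assumed to be linear subspaces. A sequence $\{T_n\}_{n=1}^\infty$ of bounded linear operators on $H$ is hypercyclic if there is $x \in H$ such that $\{T_n x : n = 1, 2, \ldots\}$ is dense in $H$. *)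

(* Defs.v *)
From mathcomp Require Import all_boot all_order all_algebra.
From mathcomp Require Import complex.
From mathcomp Require Import all_classical all_reals all_analysis.

Set Implicit Arguments.
Unset Strict Implicit.
Unset Printing Implicit Defensive.

Import Order.TTheory GRing.Theory Num.Theory.
Import numFieldNormedType.Exports.
Local Open Scope classical_set_scope.
Local Open Scope ring_scope.

(* A Hilbert space may be real or complex; both cases are covered by letting
   the scalars range over this two-element type. *)
Variant scalars := RealScalars | ComplexScalars.

Definition scalar_field (R : realType) (s : scalars) : numFieldType :=
  match s with
  | RealScalars => R
  | ComplexScalars => R[i]
  end.

Definition scalar_conj (R : realType) (s : scalars) :
    scalar_field R s -> scalar_field R s :=
  match s with
  | RealScalars => idfun
  | ComplexScalars => @conjc R
  end.

Section Spaces.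
Variables (K : numFieldType) (H : normedModType K).

Definition norm_from_dot (theta : K -> K) (dot : {dot H for theta}) : Prop :=
  forall x : H, `|x| ^+ 2 = dot x x.

Definition separable_space : Prop :=
  exists2 D : set H, countable D & dense D.

Definition infinite_dimensional : Prop :=
  ~ exists (n : nat) (e : 'I_n -> H),
      forall x : H, exists c : 'I_n -> K, x = \sum_(i < n) c i *: e i.

Definition bounded_operator (T : {linear H -> H}) : Prop :=
  exists M : K, forall x : H, `|T x| <= M * `|x|.

(* Sequences are indexed from 0 instead of 1. *)

Definition hypercyclic_sequence (T_ : nat -> H -> H) : Prop :=
  exists x : H, dense (range (fun k => T_ k x)).

(* The maps S_{n_k} : Z -> H are given as total functions, of which only the
   values on Z matter; S is indexed by the exponent n_k, not by k. *)
Definition hypercyclicity_criterion (T : H -> H) : Prop :=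
  exists (Y Z : set H) (n : nat -> nat),
    [/\ dense Y, dense Z, forall k, (0 < n k)%N,
        forall y, Y y -> (fun k => iter (n k) T y) @ \oo --> (0 : H)
      & exists S : nat -> H -> H, forall z, Z z ->
          (fun k => S (n k) z) @ \oo --> (0 : H) /\
          (fun k => iter (n k) T (S (n k) z)) @ \oo --> z].

End Spaces.

Arguments separable_space {K} H.
Arguments infinite_dimensional {K} H.

(* Main.v *)
Require Import Defs.
From mathcomp Require Import all_boot all_order all_algebra.
From mathcomp Require Import complex.
From mathcomp Require Import all_classical all_reals all_analysis.

Set Implicit Arguments.
Unset Strict Implicit.
Unset Printing Implicit Defensive.

Import Order.TTheory GRing.Theory Num.Theory.
Import numFieldNormedType.Exports.
Local Open Scope classical_set_scope.
Local Open Scope ring_scope.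

(* Call a sequence of maps mixing if the images of any non-empty open set
   eventually meet any other one, which is (iii) for the powers T^(n_k).
   (i) => (ii): y + S_(n_k) z is eventually close to y with image close to z, so
   the T^(n_k) are mixing, and Baire's theorem gives a dense orbit.
   (ii) => (iii): let x have a dense orbit along n. For each i some w_i in the
   orbit of x and some k_i >= i make T^j w_i small and T^(n_(k_i)) T^j w_i close
   to T^j x for all j <= i; hence the criterion holds along n_(k_i) with Z the
   orbit of x, and the subsequence is mixing.
   (iii) => (i): take x with a dense orbit and k_i with T^(n_(k_i)) x -> 0. The
   orbit of x serves as Y since T^(n_(k_i)) T^j x = T^j T^(n_(k_i)) x, and mixing
   gives approximate preimages tending to 0 for every z in Z = H. *)

(** * Archimedean scalars *)

Lemma scalar_field_archimedean (R : realType) (s : scalars) :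
  Num.archimedean_axiom (scalar_field R s).
Proof.
case: s => /= x; first by exists (Num.bound `|x|); exact: archi_boundP.
(* The norm on [R[i]] takes complex values with zero imaginary part, so a bound for its real part
   suffices. *)
exists (Num.bound (complex.Re `|x|)).
have xR : `|x| = (complex.Re `|x|)%:C%C by rewrite RRe_real.
rewrite {1}xR -(rmorph_nat (real_complex R)) ltcR archi_boundP//.
by rewrite -lecR -xR normr_ge0.
Qed.

Lemma archimedean_ltV (K : numFieldType) (e : K) :
  Num.archimedean_axiom K -> 0 < e -> exists l : nat, l.+1%:R^-1 < e.
Proof.
move=> arch e0; have [l le] := arch e^-1; exists l.
have lt_l : e^-1 < l.+1%:R.
  rewrite -[ltLHS]ger0_norm ?invr_ge0 ?ltW//.
  by rewrite (lt_trans le)// ltr_nat.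
by rewrite invf_plt ?posrE.
Qed.

Lemma cvg_dist_lt_harmonic (K : numFieldType) (V : normedModType K)
    (u : nat -> V) (l : V) :
    Num.archimedean_axiom K -> (forall i, `|l - u i| < i.+1%:R^-1) ->
  u @ \oo --> l.
Proof.
move=> arch lu; apply/cvgrPdist_lt => e /(archimedean_ltV arch)[N Ne].
exists N => // i /= Ni; rewrite (lt_trans (lu i))// (le_lt_trans _ Ne)//.
by rewrite lef_pV2 ?posrE// ler_nat.
Qed.

(** * Dense sets under continuous maps and their iterates *)

Lemma dense_nbhs (X : topologicalType) (A B : set X) (p : X) :
  dense A -> nbhs p B -> A `&` B !=set0.
Proof.
move=> dA; rewrite nbhsE => -[W [Wo Wp] sWB].
have [q [Wq Aq]] := dA W (ex_intro _ p Wp) Wo.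
by exists q; split=> //; exact: sWB.
Qed.

Lemma dense_image (X : topologicalType) (f : X -> X) (A : set X) :
  continuous f -> dense (range f) -> dense A -> dense (f @` A).
Proof.
move=> /continuousP fc df dA W [p Wp] Wo.
have [y [Wy [q _ fq]]] := df W (ex_intro _ p Wp) Wo.
rewrite -{}fq in Wy; have [r [Wr Ar]] := dA _ (ex_intro _ q Wy) (fc W Wo).
by exists (f r); split=> //; exists r.
Qed.

Section IteratedMaps.
Variables (X : topologicalType) (f : X -> X).
Hypothesis fc : continuous f.

Lemma continuous_iter j : continuous (iter j f).
Proof.
elim: j => [|j IH] x /=; first exact: cvg_id.
exact: (@continuous_comp _ _ _ (iter j f) f x (IH x) (@fc _)).
Qed.

Lemma dense_image_iter j (A : set X) :
  dense (range f) -> dense A -> dense (iter j f @` A).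
Proof.
move=> df dA; elim: j => [|j IH]; first by rewrite image_id.
rewrite (_ : iter j.+1 f @` A = f @` (iter j f @` A)).
  exact: dense_image.
by rewrite image_comp.
Qed.

End IteratedMaps.

(** * Dense subsets of normed spaces and Baire's theorem *)

Section DenseNormed.
Variables (K : numFieldType) (V : normedModType K).

Lemma dense_setC1 (v p : V) : v != 0 -> dense (~` [set p]).
Proof.
move=> v0 O [q Oq] oO; have [qp|] := eqVneq q p; last first.
  by move=> qp; exists q; split=> // /eqP; rewrite (negbTE qp).
have /nbhs_ballP[e /= e0 eO] : nbhs q O by exact: open_nbhs_nbhs.
have nv : 0 < `|v| by rewrite normr_gt0.
have t0 : 0 < e / 2 / `|v| by rewrite !divr_gt0.
(* A shift of norm [e / 2] along [v] leaves the point [p] but not the ball of radius [e]. *)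
exists (q + e / 2 / `|v| *: v); split.
  apply: eO; rewrite -ball_normE /= opprD addNKr normrN normrZ gtr0_norm//.
  by rewrite divfK ?gt_eqF// gtr_pMr// invf_lt1// ltr1n.
move=> /eqP; rewrite /= qp -subr_eq0 addrAC subrr add0r scaler_eq0.
by rewrite (negbTE v0) gt_eqF.
Qed.

(** Points are removed one at a time: the complement of a point is open and dense, so it meets a
    dense set in a dense set. *)
Lemma dense_setD_seq (v : V) (A : set V) (s : seq V) :
  v != 0 -> dense A -> dense (A `\` [set` s]).
Proof.
move=> v0 dA; elim: s => [|p s IH]; first by rewrite set_nil setD0.
rewrite (_ : A `\` _ = ~` [set p] `&` (A `\` [set` s])).
  apply: denseI => //; last exact: dense_setC1 v0.
  by apply: closed_openC; exact: accessible_closed_set1 (hausdorff_accessible _) _.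
apply/seteqP; split=> x /=.
  move=> [Ax /negP]; rewrite inE negb_or => /andP[/eqP ? /negP ?].
  by split.
move=> [xp [Ax xs]]; split=> //; rewrite inE => /orP[/eqP //|//].
Qed.

(* Finitely many orbit points can be discarded since there are no isolated
   points, so both the index and the exponent can be made large. *)
Lemma dense_orbit_late (f : V -> V) (n : nat -> nat) (v x p : V) (B : set V)
    (i : nat) :
    v != 0 -> dense (range (fun k => iter (n k) f x)) -> nbhs p B ->
  exists k, [/\ (i <= k)%N, (i <= n k)%N & B (iter (n k) f x)].
Proof.
move=> v0 dx pB.
pose s := [seq iter (n k) f x | k <- iota 0 i] ++
          [seq iter m f x | m <- iota 0 i].
have [_ [[[k _ <-] /negP xs] Bx]] := dense_nbhs (dense_setD_seq s v0 dx) pB.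
move: xs; rewrite mem_cat negb_or => /andP[xk xn].
exists k; split=> //; rewrite leqNgt.
- by apply: contra xk => ki; apply/mapP; exists k; rewrite ?mem_iota.
- by apply: contra xn => ki; apply/mapP; exists (n k); rewrite ?mem_iota.
Qed.

End DenseNormed.

(* The library's [Baire] only covers normed modules over a [realType]. *)
Theorem archimedean_Baire (K : numFieldType) (U : completeNormedModType K)
    (F : nat -> set U) :
    Num.archimedean_axiom K -> (forall i, open (F i) /\ dense (F i)) ->
  dense (\bigcap_i F i).
Proof.
move=> arch odF D [p Dp] Do.
(* The doubled ball leaves room for the limit of the centres, which is known to lie only in the
   closed ball of radius [c.2]. *)
have shrink i (W : set U) q : open W -> W q -> exists c : U * K,
    [/\ 0 < c.2, c.2 < i.+1%:R^-1 & ball c.1 (2 * c.2) `<=` W `&` F i].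
  move=> Wo Wq; have [Fo dF] := odF i.
  have [a Wa] := dF W (ex_intro _ q Wq) Wo.
  have /nbhs_ballP[e /= e0 eW] : nbhs a (W `&` F i).
    by apply: open_nbhs_nbhs; split=> //; exact: openI.
  near (0 : K)^'+ => r; have r0 : 0 < r by [].
  exists (a, r); split=> //=.
  apply: subset_trans eW; apply: le_ball; rewrite -ler_pdivlMl//.
  by near: r; apply: nbhs_right_ltW; rewrite mulr_gt0// invr_gt0.
have [c0 [c00 c01 c0D]] := shrink 0%N D p Do Dp.
have step (ic : nat * (U * K)) : exists c : U * K, 0 < ic.2.2 ->
    [/\ 0 < c.2, c.2 < ic.1.+2%:R^-1
      & ball c.1 (2 * c.2) `<=` ball ic.2.1 ic.2.2 `&` F ic.1.+1].
  (* [choice] needs a value for every input; [c0] is a dummy for radii that are not positive. *)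
  have [ic0|] := pselect (0 < ic.2.2); last by exists c0.
  have [c cP] := shrink ic.1.+1 _ ic.2.1 (ball_open _ _) (ballxx ic.2.1 ic0).
  by exists c.
have {step}[g gP] := choice step.
pose c := fix c i := if i is j.+1 then g (j, c j) else c0.
have c_gt0 i : 0 < (c i).2 by elim: i => //= i /(gP (i, c i))[].
have c_lt i : (c i).2 < i.+1%:R^-1.
  by case: i => //= i; have [] := gP (i, c i) (c_gt0 i).
have cS i : ball (c i.+1).1 (2 * (c i.+1).2) `<=` ball (c i).1 (c i).2 `&` F i.+1.
  by have [] := gP (i, c i) (c_gt0 i).
have le2 i : (c i).2 <= 2 * (c i).2.
  by rewrite mulrDl mul1r lerDl ltW.
have c_sub i j : (i <= j)%N -> ball (c j).1 (c j).2 `<=` ball (c i).1 (c i).2.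
  elim: j => [|j IH]; first by rewrite leqn0 => /eqP ->.
  rewrite leq_eqVlt => /orP[/eqP <-//|/IH]; apply: subset_trans.
  move=> y /(le_ball (le2 _))/cS[]//.
have c_near i j : (i <= j)%N -> `|(c i).1 - (c j).1| < (c i).2.
  by move=> /c_sub/(_ _ (ballxx _ (c_gt0 j))); rewrite -ball_normE.
have : cvg ((fst \o c) @ \oo).
  apply/cauchy_cvgP/cauchy_exP => e e0.
  have [N Ne] := archimedean_ltV arch e0; exists (c N).1.
  exists N => // j /= /c_near Nj; rewrite -ball_normE /=.
  by rewrite (lt_trans Nj)// (lt_trans (c_lt N)).
move=> /cvg_ex[/= l cl]; exists l.
have lc i : ball (c i).1 (2 * (c i).2) l.
  rewrite -ball_normE /=; near \oo => j.
  rewrite (le_lt_trans (ler_distD (c j).1 _ _))// mulrDl mul1r ltrD//.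
    by apply: c_near; near: j; exact: nbhs_infty_ge.
  by rewrite distrC; near: j; move/cvgrPdist_lt: cl; apply.
split; first by have /c0D[] := lc 0%N.
by move=> [|i] _; [have /c0D[] := lc 0%N | have /cS[] := lc i.+1].
Unshelve. all: by end_near. Qed.

(** * Mixing sequences of maps *)

Definition mixing_sequence (X : topologicalType) (T_ : nat -> X -> X) : Prop :=
  forall U V : set X, open U -> open V -> U !=set0 -> V !=set0 ->
    exists N : nat, forall k, (N <= k)%N -> (T_ k @` U) `&` V !=set0.

Lemma mixing_sequence_comp (X : topologicalType) (T_ : nat -> X -> X)
    (kap : nat -> nat) : (forall i, (i <= kap i)%N) ->
  mixing_sequence T_ -> mixing_sequence (T_ \o kap).
Proof.
move=> kapi mT U V Uo Vo U0 V0; have [N NP] := mT U V Uo Vo U0 V0.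
by exists N => k Nk; apply: NP; exact: leq_trans (kapi k).
Qed.

(* Birkhoff's transitivity argument. *)
Lemma mixing_hypercyclic (K : numFieldType) (V : completeNormedModType K)
    (T_ : nat -> V -> V) :
    Num.archimedean_axiom K -> separable_space V ->
    (forall k, continuous (T_ k)) -> mixing_sequence T_ ->
  hypercyclic_sequence T_.
Proof.
move=> arch [D Dc dD] Tc mT.
have [d dP] : exists d : nat -> V, D `<=` range d.
  have /pcard_geP/surjPex[d dP] := Dc.
  by exists d.
(* Each code [i] stands for a ball with centre [d a] and radius [l.+1%:R^-1], and [F i] holds the
   points whose orbit meets it. Invalid codes merely repeat the ball of [(0, 0)]. *)
pose F i := let: (a, l) := odflt (0%N, 0%N) (unpickle i) in
  \bigcup_k (T_ k @^-1` ball (d a) l.+1%:R^-1).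
have odF i : open (F i) /\ dense (F i).
  rewrite /F; case: (odflt _ _) => a l; split.
    by apply: bigcup_open => k _; have /continuousP := Tc k; apply; exact: ball_open.
  move=> W W0 Wo.
  have [|N /(_ N (leqnn N))[_ [[y Wy <-] Ty]]] :=
      mT W (ball (d a) l.+1%:R^-1) Wo (ball_open _ _) W0.
    by exists (d a); apply: ballxx; rewrite invr_gt0.
  by exists y; split=> //; exists N.
have [x [_ xF]] := archimedean_Baire arch odF (ex_intro _ 0 I) openT.
exists x => W [p Wp] Wo.
have [y [Wd /dP[a _ ad]]] := dD W (ex_intro _ p Wp) Wo; rewrite -{}ad in Wd.
have /nbhs_ballP[e /= e0 eW] : nbhs (d a) W by exact: open_nbhs_nbhs.
have [l le] := archimedean_ltV arch e0.
have := xF (pickle (a, l)) I; rewrite /F pickleK /= => -[k _ Tx].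
exists (T_ k x); split; last by exists k.
by apply: eW; exact: le_ball (ltW le) _ Tx.
Qed.

(** The sequence [u] stands for [S_(n_k) z]. Leaving it abstract serves both a given family [S] and
    small vectors taken from a dense orbit. *)
Lemma criterion_mixing (K : numFieldType) (V : normedModType K)
    (T_ : nat -> V -> V) (Y Z : set V) :
    (forall k, {morph T_ k : x y / x + y}) -> dense Y -> dense Z ->
    (forall y, Y y -> (fun k => T_ k y) @ \oo --> (0 : V)) ->
    (forall z, Z z -> exists u : nat -> V,
      u @ \oo --> (0 : V) /\ (fun k => T_ k (u k)) @ \oo --> z) ->
  mixing_sequence T_.
Proof.
move=> TD dY dZ TY TZ U W Uo Wo U0 W0.
have [y [Uy /TY Ty]] := dY U U0 Uo.
have [z [Wz /TZ[u [u0 Tu]]]] := dZ W W0 Wo.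
have yu : (y + u k) @[k --> \oo] --> y.
  by rewrite -{2}[y]addr0; apply: cvgD u0; exact: cvg_cst.
have Tyu : T_ k (y + u k) @[k --> \oo] --> z.
  by under eq_fun do rewrite TD; rewrite -[z]add0r; exact: cvgD.
have : \forall k \near \oo, U (y + u k) /\ W (T_ k (y + u k)).
  near=> k; split; near: k; first exact: (yu U (open_nbhs_nbhs (conj Uo Uy))).
  exact: (Tyu W (open_nbhs_nbhs (conj Wo Wz))).
move=> [N _ NP]; exists N => k /NP[Uk Wk].
by exists (T_ k (y + u k)); split=> //; exists (y + u k).
Unshelve. all: by end_near. Qed.

(** The empty family spans the zero space. A nonzero vector later rules out isolated points. *)
Lemma nonzero_of_infinite_dimensional (K : numFieldType) (V : normedModType K) :
  infinite_dimensional V -> exists v : V, v != 0.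
Proof.
move=> Vinf; apply: contrapT => V0; apply: Vinf.
exists 0%N, (fun=> 0) => x; exists (fun=> 0); rewrite big_ord0.
by apply/eqP; apply: contrapT => /negP x0; apply: V0; exists x.
Qed.

(** * Powers of a bounded operator *)

Section BoundedOperators.
Variables (K : numFieldType) (V : normedModType K) (T : {linear V -> V}).

Lemma bounded_operator_continuous : bounded_operator T -> continuous T.
Proof.
move=> [M TM]; apply/bounded_linear_continuous/bounded_funP => r.
exists (`|M| * r) => x xr; rewrite (le_trans (TM x))//.
(* The scalar [M] has no prescribed sign, but the product dominates a norm and so equals its own
   absolute value. *)
have -> : M * `|x| = `|M| * `|x|.
  by rewrite -[LHS]ger0_norm ?normrM ?normr_id// (le_trans _ (TM x)).
by rewrite ler_wpM2l.
Qed.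

Lemma iter_morphD j : {morph iter j T : x y / x + y}.
Proof. by move=> x y; elim: j => //= j ->; rewrite linearD. Qed.

Lemma iter_linear0 j : iter j T 0 = 0.
Proof. by elim: j => //= j ->; rewrite linear0. Qed.

Lemma iter_comm i j (x : V) : iter i T (iter j T x) = iter j T (iter i T x).
Proof. by rewrite -!iterD addnC. Qed.

Lemma dense_range_of_orbit (n : nat -> nat) (x : V) :
    (forall k, (0 < n k)%N) -> dense (range (fun k => iter (n k) T x)) ->
  dense (range T).
Proof.
move=> n0 dx W W0 Wo; have [y [Wy [k _ xy]]] := dx W W0 Wo.
exists y; split=> //; exists (iter (n k).-1 T x) => //.
by rewrite -iterS prednK.
Qed.

Lemma dense_full_orbit (n : nat -> nat) (x : V) :
    dense (range (fun k => iter (n k) T x)) ->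
  dense (range (fun j => iter j T x)).
Proof.
move=> dx W W0 Wo; have [y [Wy [k _ xy]]] := dx W W0 Wo.
by exists y; split=> //; exists (n k).
Qed.

Hypothesis Tc : continuous T.

(* A small orbit point w of x with T^(n_k) w close to x exists, because every
   orbit point of x again has a dense orbit along n. *)
Lemma hypercyclic_mixing_subsequence (v : V) (Y : set V) (n : nat -> nat) :
    Num.archimedean_axiom K -> v != 0 -> dense Y -> (forall k, (0 < n k)%N) ->
    hypercyclic_sequence (fun k => iter (n k) T) ->
    (forall y, Y y -> (fun k => iter (n k) T y) @ \oo --> (0 : V)) ->
  exists kap : nat -> nat, mixing_sequence (fun i => iter (n (kap i)) T).
Proof.
move=> arch v0 dY n0 [x dx] TY.
have dT : dense (range T) := dense_range_of_orbit n0 dx.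
have nbhs_iter i (p : V) : nbhs p (fun w => forall j : 'I_i.+1,
    `|iter j T p - iter j T w| < i.+1%:R^-1).
  apply: filter_forall => j.
  have /cvgrPdist_lt := @continuous_iter _ _ Tc j p; apply.
  by rewrite invr_gt0.
have step i : exists kw : nat * V, [/\ (i <= kw.1)%N,
    forall j : 'I_i.+1, `|iter j T kw.2| < i.+1%:R^-1
  & forall j : 'I_i.+1,
      `|iter j T x - iter (n kw.1) T (iter j T kw.2)| < i.+1%:R^-1].
  have [k0 [_ _ w0]] := dense_orbit_late 0 v0 dx (nbhs_iter i 0).
  (* This orbit is the image of the dense orbit of [x] under a power of [T], and [T] has dense
     range. *)
  have dw : dense (range (fun k => iter (n k) T (iter (n k0) T x))).
    under eq_fun do rewrite iter_comm.
    by rewrite -image_comp; exact: dense_image_iter.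
  have [k [ik _ kx]] := dense_orbit_late i v0 dw (nbhs_iter i x).
  exists (k, iter (n k0) T x); split=> //= j.
  - by have := w0 j; rewrite iter_linear0 sub0r normrN.
  - by have := kx j; rewrite (iter_comm j).
have [kw kwP] := choice step.
exists (fun i => (kw i).1).
apply: (criterion_mixing (fun i => iter_morphD _) dY (dense_full_orbit dx)).
  move=> y /TY Ty; apply: cvg_comp Ty => B [N _ NB]; exists N => // i /= Ni.
  by apply: NB => /=; have [+ _ _] := kwP i; exact: leq_trans.
move=> _ [j _ <-]; exists (fun i => iter j T (kw i).2).
(* The bounds for a fixed [j] start at [i = j], hence the shift by [j]. *)
have near_small (u : nat -> V) (l : V) :
    (forall i, (j < i.+1)%N -> `|l - u i| < i.+1%:R^-1) -> u @ \oo --> l.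
  move=> lu; rewrite -(cvg_shiftn j); apply: cvg_dist_lt_harmonic => // i.
  rewrite /= (lt_le_trans (lu _ _))// ?ltnS ?leq_addl//.
  by rewrite lef_pV2 ?posrE// ler_nat ltnS leq_addr.
split; apply: near_small => i ji; have [_ small close] := kwP i.
  by rewrite sub0r normrN; exact: (small (Ordinal ji)).
exact: (close (Ordinal ji)).
Qed.

(** As [S] is indexed by the exponent, indices with equal exponents must share one approximate
    preimage. It is chosen as good as possible for the exponent [m], among precision levels up to
    [m]. *)
Lemma mixing_criterion (v x : V) (n : nat -> nat) :
    Num.archimedean_axiom K -> v != 0 -> (forall k, (0 < n k)%N) ->
    dense (range (fun k => iter (n k) T x)) ->
    mixing_sequence (fun k => iter (n k) T) ->
  hypercyclicity_criterion T.
Proof.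
move=> arch v0 n0 dx mT.
(* Large indices keep the subsequence mixing; large exponents let the precision cap grow. *)
have step i : exists k, [/\ (i <= k)%N, (i <= n k)%N
    & ball 0 i.+1%:R^-1 (iter (n k) T x)].
  by apply: (dense_orbit_late i v0 dx); apply: nbhsx_ballx; rewrite invr_gt0.
have [kap kapP] := choice step.
have {}mT : mixing_sequence (fun i => iter (n (kap i)) T).
  by apply: (mixing_sequence_comp _ mT) => i; have [] := kapP i.
pose good l m (z w : V) := `|w| < l.+1%:R^-1 /\ `|z - iter m T w| < l.+1%:R^-1.
have good_le l l' m z w : (l <= l')%N -> good l' m z w -> good l m z w.
  have le : (l <= l')%N -> l'.+1%:R^-1 <= l.+1%:R^-1 :> K.
    by move=> ll'; rewrite lef_pV2 ?posrE// ler_nat.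
  by move=> /le ll' [w1 w2]; split; exact: lt_le_trans ll'.
(* A witness for the highest attainable level up to [L] serves all lower levels; [0] is a dummy when
   no level is attainable. Without a cap [L] there might be no highest level. *)
have best L m z : exists w, forall l, (l <= L)%N ->
    (exists w', good l m z w') -> good l m z w.
  elim: L => [|L [w wP]].
    have [[w ?]|w0] := pselect (exists w, good 0%N m z w).
      by exists w => l; rewrite leqn0 => /eqP ->.
    by exists 0 => l; rewrite leqn0 => /eqP -> /w0.
  have [[w' w'P]|w'0] := pselect (exists w', good L.+1 m z w').
    by exists w' => l lL _; exact: good_le lL w'P.
  exists w => l; rewrite leq_eqVlt => /orP[/eqP -> /w'0//|].
  exact: wP.
have [S SP] := choice (fun mz : nat * V => best mz.1 mz.1 mz.2).
have S_good z l : \forall i \near \oo, good l (n (kap i)) z (S (n (kap i), z)).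
  have l0 : 0 < l.+1%:R^-1 :> K by rewrite invr_gt0.
  have [||N NP] := mT _ _ (ball_open (0 : V) l.+1%:R^-1) (ball_open z l.+1%:R^-1).
  - by exists 0; exact: ballxx.
  - by exists z; exact: ballxx.
  exists (maxn N l) => // i /=; rewrite geq_max => /andP[Ni li].
  apply: (SP (n (kap i), z)) => /=.
    by have [_ + _] := kapP i; exact: leq_trans.
  have [_ [[w + <-]]] := NP i Ni.
  by rewrite -ball_normE /= sub0r normrN => w0 wz; exists w.
exists (range (fun j => iter j T x)), setT, (n \o kap); split.
- exact: dense_full_orbit dx.
- by move=> W [p Wp] _; exists p.
- by move=> k; exact: n0.
- move=> _ [j _ <-] /=; under eq_fun do rewrite iter_comm.
  rewrite -(iter_linear0 j).
  apply: (@cvg_comp _ _ _ (fun i => iter (n (kap i)) T x) (iter j T));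
    last exact: (@continuous_iter _ _ Tc).
  apply: cvg_dist_lt_harmonic => // i.
  by have [_ _] := kapP i; rewrite -ball_normE.
- exists (fun m z => S (m, z)) => z _; split; apply/cvgrPdist_lt => e e0.
    have [l le] := archimedean_ltV arch e0.
    apply: filterS (S_good z l) => i [Si _].
    by rewrite sub0r normrN (lt_trans Si).
  have [l le] := archimedean_ltV arch e0.
  by apply: filterS (S_good z l) => i [_ Si]; rewrite (lt_trans Si).
Qed.

End BoundedOperators.

Theorem proposition2p12 (R : realType) (s : scalars)
    (H : completeNormedModType (scalar_field R s))
    (dot : {dot H for @scalar_conj R s}) (T : {linear H -> H})
    (H_hilbert : norm_from_dot dot)
    (H_separable : separable_space H)
    (H_infinite_dimensional : infinite_dimensional H)
    (T_bounded : bounded_operator T) :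
  [<-> hypercyclicity_criterion T;
       exists (Y : set H) (n : nat -> nat),
         [/\ dense Y, forall k, (0 < n k)%N,
             hypercyclic_sequence (fun k => iter (n k) T)
           & forall y, Y y -> (fun k => iter (n k) T y) @ \oo --> (0 : H)];
       exists n : nat -> nat,
         (forall k, (0 < n k)%N) /\
         forall U V : set H, open U -> open V -> U !=set0 -> V !=set0 ->
           exists N : nat, forall k, (N <= k)%N ->
             (iter (n k) T @` U) `&` V !=set0].
Proof.
have arch := @scalar_field_archimedean R s.
have [v v0] := nonzero_of_infinite_dimensional H_infinite_dimensional.
have Tc := bounded_operator_continuous T_bounded.
have mixing_hc (n : nat -> nat) : mixing_sequence (fun k => iter (n k) T) ->
    hypercyclic_sequence (fun k => iter (n k) T).
  by apply: mixing_hypercyclic => // k; exact: continuous_iter.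
tfae.
- move=> [Y [Z [n [dY dZ n0 TY [S SP]]]]]; exists Y, n; split=> //.
  apply: mixing_hc.
  apply: (criterion_mixing (fun k => iter_morphD _ _) dY dZ TY) => z /SP[].
  by exists (fun k => S (n k) z).
- move=> [Y [n [dY n0 hcT TY]]].
  have [kap mT] := hypercyclic_mixing_subsequence Tc arch v0 dY n0 hcT TY.
  by exists (n \o kap); split=> [k|//]; exact: n0.
- move=> [n [n0 mT]]; have [x dx] := mixing_hc n mT.
  exact: (mixing_criterion Tc arch v0 n0 dx mT).
Qed.
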